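(* Let $P(t)=\binom{r+t}{r}-\binom{r+t-d}{r}$ and let $x\in\mathrm{Hilb}^P(\mathbb{P}^r_k)$ be unstable at level $d$ with $x\in E_{d,[\lambda],\delta}$, where $\lambda=(a_0,\dots,a_r)\in\Gamma(T)$ is indivisible (so $\sum_{i=0}^r a_i=0$) and $\delta>0$. Let $b=\max_i a_i$ and $a=\min_i a_i$. Then the multiplicity $n_{H_x}$ of the hypersurface $H_x$ represented by $x$ satisfies $$\frac{\Vert\lambda\Vert\delta-ad}{b-a}\;\le\; n_{H_x}\;\le\;\frac{rd}{r+1}-\delta\,\frac{a}{\Vert\lambda\Vert}.$$
   Context: Let $k$ be an algebraically closed field, $r\ge1$, $d\ge1$, $S=k[x_0,\dots,x_r]$, $S_d$ its degree-$d$ part. With $P(t)=\binom{r+t}{r}-\binom{r+t-d}{r}$, a point $x$ of $\mathrm{Hilb}^P(\mathbb{P}^r_k)$ is a hypersurface $H_x=V(f)$, $0\ne f\in S_d$, with $d$-th Hilbert point $\phi_d(x)=[f]\in\mathbb{P}(S_d)$. $G=\mathrm{GL}_{r+1}(k)$ acts on $S_1=\mathrm{span}(x_0,\dots,x_r)$ by the standard representation and hence on $S$ and on the Hilbert scheme; $H=\mathrm{SL}_{r+1}(k)$, $T$ its diagonal torus. $\lambda=(a_0,\dots,a_r)\in\mathbb{Z}^{r+1}$, $\sum a_i=0$, denotes $s\mapsto\mathrm{diag}(s^{a_0},\dots,s^{a_r})\in\Gamma(T)$; it multiplies $x_0^{e_0}\cdots x_r^{e_r}$ by $s^{\sum a_ie_i}$.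 $\Vert\cdot\Vert$ is a conjugation-invariant norm on one-parameter subgroups of $G$ equal to the Euclidean norm on diagonal ones. For $\lambda\in\Gamma(H)$, $\mu(\phi_d(x),\lambda)$ is the minimal $i$ such that the $s^i$-weight component of $f$ under $\lambda$ is nonzero. $\Lambda_{x,d}$ is the set of indivisible $\lambda\in\Gamma(H)$ (not an integer multiple $\ge2$ of another) maximizing $\mu(\phi_d(x),\lambda)/\Vert\lambda\Vert$; $x$ is unstable at level $d$ if this maximum is positive. For indivisible $\lambda\in\Gamma(T)$ and $\delta>0$, the Hesselink stratum $E_{d,[\lambda],\delta}$ is the set of $x$ such that $\Lambda_{x,d}$ meets the $G$-conjugacy class $[\lambda]$ and the maximal value of $\mu(\phi_d(x),\cdot)/\Vert\cdot\Vert$ is $\delta$. Multiplicity: for $X=V(f)$ and $e=[1:0:\cdots:0]$, writing $f=\sum_j x_0^{d-j}f_j(x_1,\dots,x_r)$ with $f_j$ homogeneous of degree $j$, $n_{e,X}=\min\{j:f_j\ne0\}$; for a point $p$, $n_{p,X}$ is defined likewise after a linear coordinate change sending $p$ to $e$ (coordinate independent; equal to the degree of the tangent cone at $p$), and $n_X=\max_{p}n_{p,X}$. *)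

(* Defs.v *)
From HB Require Import structures.
From mathcomp Require Import all_boot all_order all_algebra all_field.
From Stdlib Require Import ClassicalEpsilon.
Set Implicit Arguments. Unset Strict Implicit. Unset Printing Implicit Defensive.
Import Order.TTheory GRing.Theory Num.Theory.
Local Open Scope ring_scope.

Notation monom r d :=
  {e : {ffun 'I_r.+1 -> 'I_d.+1} | (\sum_i (e i : nat) == d)%N}.

Definition Form (k : closedFieldType) (r d : nat) := {ffun monom r d -> k}.

Definition evalF (k : closedFieldType) (r d : nat) (f : Form k r d)
  (v : 'cV[k]_r.+1) : k :=
  \sum_(e : monom r d) f e * \prod_(i < r.+1) v i 0 ^+ ((sval e) i : nat).

(* Action of g in GL_{r+1} on S_d induced by the standard representation on
   S_1 (g . x_j = sum_i g_ij x_i): (g . f)(x) = f(g^T x).  Defined as the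
   (unique) form with that polynomial function. *)
Definition act (k : closedFieldType) (r d : nat) (g : 'M[k]_r.+1)
  (f : Form k r d) : Form k r d :=
  epsilon (inhabits [ffun => 0])
    (fun F : Form k r d => forall v, evalF F v = evalF f (g^T *m v)).

Definition wt (r d : nat) (a : {ffun 'I_r.+1 -> int}) (e : monom r d) : int :=
  \sum_i a i * (((sval e) i : nat))%:Z.

(* minimum of a nonempty list of integers (0 for the empty list) *)
Definition minz (s : seq int) : int :=
  foldr (fun x y => if x < y then x else y) (head 0 s) s.

Definition mu_diag (k : closedFieldType) (r d : nat)
  (a : {ffun 'I_r.+1 -> int}) (F : Form k r d) : int :=
  minz [seq wt a e | e <- enum {: monom r d} & F e != 0].

(* A one-parameter subgroup of H = SL_{r+1} is s |-> g diag(s^a) g^{-1}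
   with g in GL_{r+1}, sum a = 0.  mu(f, g lambda_a g^{-1}) = mu(g^{-1}.f, lambda_a). *)
Definition mu (k : closedFieldType) (r d : nat) (f : Form k r d)
  (g : 'M[k]_r.+1) (a : {ffun 'I_r.+1 -> int}) : int :=
  mu_diag a (act (invmx g) f).

(* Euclidean norm (conjugation invariant) *)
Definition normv (r : nat) (a : {ffun 'I_r.+1 -> int}) : algC :=
  sqrtC (\sum_i ((a i) ^+ 2)%:~R).

Definition ratio (k : closedFieldType) (r d : nat) (f : Form k r d)
  (g : 'M[k]_r.+1) (a : {ffun 'I_r.+1 -> int}) : algC :=
  (mu f g a)%:~R / normv a.

Definition indivisible (r : nat) (a : {ffun 'I_r.+1 -> int}) : Prop :=
  ~ (exists (m : nat) (c : {ffun 'I_r.+1 -> int}),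
        (1 < m)%N /\ forall i, a i = c i * m%:Z).

(* x in E_{d,[lambda_a],delta}: the maximum of mu/||.|| over nontrivial
   one-parameter subgroups of H is delta, and it is attained by some
   G-conjugate g lambda_a g^{-1} of lambda_a. *)
Definition in_stratum (k : closedFieldType) (r d : nat) (f : Form k r d)
  (a : {ffun 'I_r.+1 -> int}) (delta : algC) : Prop :=
  (exists g : 'M[k]_r.+1, g \in unitmx /\ ratio f g a = delta) /\
  (forall (h : 'M[k]_r.+1) (c : {ffun 'I_r.+1 -> int}),
      h \in unitmx -> \sum_i c i = 0 -> c != 0 -> ratio f h c <= delta).

(* n_{e,X}: min { j : f_j != 0 }, f = sum_j x_0^{d-j} f_j(x_1..x_r);
   the monomial x^e lies in f_j with j = d - e_0.  (Default d if f = 0.) *)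
Definition mult_e (k : closedFieldType) (r d : nat) (F : Form k r d) : nat :=
  foldr minn d [seq (d - nat_of_ord (sval e (@ord0 r)))%N | e : monom r d <- enum {: monom r d} & F e != 0].

Definition e0 (k : closedFieldType) (r : nat) : 'cV[k]_r.+1 :=
  \col_i (if i == ord0 then 1 else 0).

(* n_{p,X}: after a linear coordinate change sending p to e
   (new coordinates x' with x = g^T x', g^T e = p), n_{e, V(g.f)}. *)
Definition mult_pt (k : closedFieldType) (r d : nat) (f : Form k r d)
  (p : 'cV[k]_r.+1) : nat :=
  let g := epsilon (inhabits 1%:M)
             (fun g : 'M[k]_r.+1 => g \in unitmx /\ g^T *m e0 k r = p) in
  mult_e (act g f).

Definition attained (k : closedFieldType) (r d : nat) (f : Form k r d)
  (j : nat) : bool :=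
  if excluded_middle_informative
       (exists p : 'cV[k]_r.+1, p != 0 /\ mult_pt f p = j) then true else false.

(* n_X = max over points p of n_{p,X}  (all values lie in [0, d]) *)
Definition multX (k : closedFieldType) (r d : nat) (f : Form k r d) : nat :=
  \max_(j < d.+1 | attained f j) (j : nat).

Definition maxa (r : nat) (a : {ffun 'I_r.+1 -> int}) : int :=
  \big[Order.max/a ord0]_i a i.
Definition mina (r : nat) (a : {ffun 'I_r.+1 -> int}) : int :=
  \big[Order.min/a ord0]_i a i.

(* Main.v *)
(* Let F be f in coordinates diagonalizing lambda = (a_0, .., a_r), and let
   m = ||lambda|| delta be its minimal lambda-weight.  If a_j = a is minimal, a
   monomial x^e of F satisfies m <= a d + (b - a)(d - e_j), which bounds the
   multiplicity at the j-th coordinate point from below.  Conversely let p have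
   multiplicity n.  After a substitution in the parabolic subgroup of lambda,
   which does not decrease lambda-weights, p is the j-th coordinate point for
   some j, and then the vector c with c_j = -r and all other entries 1 has all
   its weights >= (r+1) n - r d.  Optimality of lambda among the N lambda + c,
   N -> oo, gives ||lambda||^2 ((r+1) n - r d) <= m <lambda, c> = - m (r+1) a_j,
   and -a_j <= -a. *)
Require Import Defs.
From HB Require Import structures.
From mathcomp Require Import all_boot all_order all_algebra all_field.
From mathcomp Require Import perm ring zify.
From Stdlib Require Import ClassicalEpsilon.
Import Order.TTheory GRing.Theory Num.Theory.
Local Open Scope ring_scope.
Set Implicit Arguments. Unset Strict Implicit. Unset Printing Implicit Defensive.

(** * Forms are determined by their values *)

Lemma poly_horner_eq0 (k : closedFieldType) (p : {poly k}) :
  (forall x, p.[x] = 0) -> p = 0.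
Proof.
(* [p + 1] takes only the value 1, so it has no root and must be constant. *)
move=> p0; case: (boolP (size (p + 1) == 1%N)) => [sz1|].
  have /size1_polyC pE : (size (p + 1)%R <= 1)%N by rewrite (eqP sz1).
  have := congr1 (horner^~ 0) pE; rewrite /= hornerD p0 !hornerC add0r => c1.
  by apply: (addIr 1); rewrite pE -c1 add0r.
by case/closed_rootP=> x; rewrite rootE hornerD p0 hornerC add0r oner_eq0.
Qed.

Lemma digits_inj (B n : nat) (u v : 'I_n -> nat) :
  (forall i, u i < B)%N -> (forall i, v i < B)%N ->
  (\sum_(i < n) u i * B ^ i = \sum_(i < n) v i * B ^ i)%N -> u =1 v.
Proof.
elim: n u v => [|n IHn] u v ltuB ltvB; first by move=> _ [].
have B_gt0 : (0 < B)%N by apply: leq_ltn_trans (ltuB ord0).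
have shift (w : 'I_n.+1 -> nat) : (\sum_(i < n.+1) w i * B ^ i =
    (\sum_(i < n) w (lift ord0 i) * B ^ i) * B + w ord0)%N.
  rewrite big_ord_recl expn0 muln1 addnC big_distrl /=; congr addn.
  by apply: eq_bigr => i _; rewrite expnSr mulnA.
rewrite !shift => eq_uv.
have eq0 : u ord0 = v ord0.
  by have := congr1 (modn^~ B) eq_uv; rewrite /= !modnMDl !modn_small.
move: eq_uv; rewrite eq0 => /addIn/eqP; rewrite eqn_pmul2r // => /eqP eqS i.
by have [j ->|->] := unliftP ord0 i; first exact: IHn eqS j.
Qed.

(** Exponents are at most [d], hence they are the base [d.+1] digits of [w e]; substituting
    [s ^+ (d.+1 ^ i)] for the [i]-th variable keeps monomials apart and reduces to one variable.
    This gives the uniqueness behind [act]. *)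
Lemma evalF_inj (k : closedFieldType) (r d : nat) (F G : Form k r d) :
  (forall v, evalF F v = evalF G v) -> F = G.
Proof.
move=> eqFG.
pose w (e : monom r d) := (\sum_(i < r.+1) (sval e i : nat) * d.+1 ^ i)%N.
have w_inj : injective w.
  move=> e e' /digits_inj eq_ee'; apply/val_inj/ffunP => i; apply/val_inj.
  by apply: eq_ee' => j; apply: ltn_ord.
pose P (E : Form k r d) : {poly k} := \sum_e E e *: 'X^(w e).
have P_coef E e : (P E)`_(w e) = E e.
  rewrite coef_sum (bigD1 e) //= coefZ coefXn eqxx mulr1 big1 ?addr0 // => e' ne.
  by rewrite coefZ coefXn (inj_eq w_inj) eq_sym (negPf ne) mulr0.
(* Kronecker substitution *)
have P_horner E s : (P E).[s] = evalF E (\col_i s ^+ (d.+1 ^ i)).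
  rewrite horner_sum; apply: eq_bigr => e _; rewrite hornerZ hornerXn.
  congr (_ * _); rewrite -prodrXr; apply: eq_bigr => i _.
  by rewrite mxE -exprM mulnC.
have eqP : P F = P G.
  apply/eqP; rewrite -subr_eq0; apply/eqP/poly_horner_eq0 => s.
  by rewrite hornerD hornerN !P_horner eqFG subrr.
by apply/ffunP => e; rewrite -!P_coef eqP.
Qed.

(** * Lower bounds on weights under sums, products and linear substitutions *)

Section Weights.
Variables (k : closedFieldType) (r : nat).
Implicit Types (a : {ffun 'I_r.+1 -> int}) (m : int) (phi : 'cV[k]_r.+1 -> k).

Definition weights_ge d a m (F : Form k r d) : Prop :=
  forall e, F e != 0 -> m <= wt a e.

(** Stated for functions, so that products and substitutions are handled pointwise; [evalF_inj]
    leads back to coefficients. *)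
Definition weighted_form d a m phi : Prop :=
  exists F : Form k r d, weights_ge a m F /\ forall v, phi v = evalF F v.

Lemma eq_weighted_form d a m phi psi :
  phi =1 psi -> weighted_form d a m phi -> weighted_form d a m psi.
Proof. by move=> e [F [wF evF]]; exists F; split=> // v; rewrite -e. Qed.

Lemma weighted_form0 d a m : weighted_form d a m (fun=> 0).
Proof.
exists [ffun=> 0]; split=> [e|v]; first by rewrite ffunE eqxx.
by rewrite /evalF big1 // => e _; rewrite ffunE mul0r.
Qed.

Lemma weighted_formD d a m phi psi :
  weighted_form d a m phi -> weighted_form d a m psi ->
  weighted_form d a m (fun v => phi v + psi v).
Proof.
move=> [F [wF evF]] [G [wG evG]]; exists [ffun e => F e + G e]; split=> [e|v].
  rewrite ffunE; have [-> | /wF //] := eqVneq (F e) 0.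
  by rewrite add0r => /wG.
rewrite evF evG /evalF -big_split; apply: eq_bigr => e _.
by rewrite ffunE mulrDl.
Qed.

Lemma weighted_formZ d a m c phi :
  weighted_form d a m phi -> weighted_form d a m (fun v => c * phi v).
Proof.
move=> [F [wF evF]]; exists [ffun e => c * F e]; split=> [e|v].
  by rewrite ffunE mulf_eq0 negb_or => /andP[_ /wF].
by rewrite evF /evalF big_distrr /=; apply: eq_bigr => e _; rewrite ffunE mulrA.
Qed.

Lemma weighted_form_sum (I : finType) d a m (phi : I -> 'cV[k]_r.+1 -> k) :
  (forall i, weighted_form d a m (phi i)) ->
  weighted_form d a m (fun v => \sum_i phi i v).
Proof.
move=> wphi; elim: (index_enum I) => [|i s IHs].
  apply: eq_weighted_form (weighted_form0 d a m) => v; by rewrite big_nil.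
by apply: eq_weighted_form (weighted_formD (wphi i) IHs) => v; rewrite big_cons.
Qed.

Lemma weighted_form_monomial d a m (u : 'I_r.+1 -> nat) :
  (\sum_i u i = d)%N -> m <= \sum_i a i * (u i)%:Z ->
  weighted_form d a m (fun v => \prod_i v i 0 ^+ u i).
Proof.
move=> sum_u le_m.
have le_ud i : (u i <= d)%N by rewrite -sum_u (bigD1 i) //= leq_addr.
pose e : {ffun 'I_r.+1 -> 'I_d.+1} := [ffun i => inord (u i)].
have eE i : e i = u i :> nat by rewrite ffunE inordK ?ltnS.
have sum_e : (\sum_i (e i : nat) == d)%N.
  by apply/eqP; rewrite -[RHS]sum_u; apply: eq_bigr => i _; rewrite eE.
pose eM : monom r d := exist _ e sum_e.
exists [ffun e' => (e' == eM)%:R]; split=> [e'|v].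
  rewrite ffunE; have [-> _|] := eqVneq e' eM; last by rewrite eqxx.
  by rewrite /wt; under eq_bigr do rewrite eE.
rewrite /evalF (bigD1 eM) //= ffunE eqxx mul1r [X in _ + X]big1 => [|e' ne].
  by rewrite addr0; apply: eq_bigr => i _; rewrite eE.
by rewrite ffunE (negPf ne) mul0r.
Qed.

Lemma weighted_formM d d' a m m' phi psi :
  weighted_form d a m phi -> weighted_form d' a m' psi ->
  weighted_form (d + d') a (m + m') (fun v => phi v * psi v).
Proof.
move=> [F [wF evF]] [G [wG evG]].
pose mono (e : monom r d) (e' : monom r d') (v : 'cV[k]_r.+1) :=
  \prod_i v i 0 ^+ (sval e i + sval e' i).
have FG v : phi v * psi v = \sum_e \sum_e' F e * (G e' * mono e e' v).
  rewrite evF evG /evalF big_distrl /=; apply: eq_bigr => e _.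
  rewrite big_distrr; apply: eq_bigr => e' _ /=.
  rewrite mulrACA -mulrA -big_split /=; congr (_ * (_ * _)).
  by apply: eq_bigr => i _; rewrite exprD.
apply: eq_weighted_form (fun v => esym (FG v)) _.
apply: weighted_form_sum => e; apply: weighted_form_sum => e'.
(* The weight bounds say nothing about monomials with zero coefficient, so these are discarded
   first. *)
have [F0|F_neq0] := eqVneq (F e) 0.
  by apply: eq_weighted_form (weighted_form0 _ _ _) => v; rewrite F0 mul0r.
have [G0|G_neq0] := eqVneq (G e') 0.
  by apply: eq_weighted_form (weighted_form0 _ _ _) => v; rewrite G0 mul0r mulr0.
do 2!apply: weighted_formZ; apply: weighted_form_monomial.
  by rewrite big_split (eqP (valP e)) (eqP (valP e')).
apply: le_trans (lerD (wF e F_neq0) (wG e' G_neq0)) _.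
rewrite /wt -big_split le_eqVlt; apply/orP; left; apply/eqP/eq_bigr => i _.
by rewrite PoszD mulrDr.
Qed.

Lemma weighted_form1 a : weighted_form 0 a 0 (fun=> 1).
Proof.
have := @weighted_form_monomial 0 a 0 (fun=> 0%N).
rewrite big1 // big1 => [H|i _]; last by rewrite mulr0.
apply: eq_weighted_form (H erefl (lexx _)) => v.
by rewrite big1.
Qed.

Lemma weighted_form_le d a m m' phi :
  m' <= m -> weighted_form d a m phi -> weighted_form d a m' phi.
Proof.
by move=> le_m [F [wF evF]]; exists F; split=> // e /wF; apply: le_trans.
Qed.

Lemma weighted_formX d a m phi n :
  weighted_form d a m phi ->
  weighted_form (d * n) a (m * n%:Z) (fun v => phi v ^+ n).
Proof.
move=> wphi; elim: n => [|n IHn].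
  by rewrite muln0 mulr0; apply: weighted_form1.
rewrite mulnS -addn1 PoszD mulrDr addrC mulr1 addn1.
by apply: eq_weighted_form (weighted_formM wphi IHn) => v; rewrite exprS.
Qed.

Lemma weighted_form_prod (I : Type) (s : seq I) (d : I -> nat) a (m : I -> int)
  (phi : I -> 'cV[k]_r.+1 -> k) :
  (forall i, weighted_form (d i) a (m i) (phi i)) ->
  weighted_form (\sum_(i <- s) d i) a (\sum_(i <- s) m i)
    (fun v => \prod_(i <- s) phi i v).
Proof.
move=> wphi; elim: s => [|i s IHs].
  rewrite !big_nil; apply: eq_weighted_form (weighted_form1 a) => v.
  by rewrite big_nil.
rewrite !big_cons; apply: eq_weighted_form (weighted_formM (wphi i) IHs) => v.
by rewrite big_cons.
Qed.

Lemma weighted_form_linear a (u : 'I_r.+1 -> k) m :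
  (forall j, u j != 0 -> m <= a j) ->
  weighted_form 1 a m (fun v => \sum_j u j * v j 0).
Proof.
move=> le_m; apply: weighted_form_sum => j.
have [u0|/le_m le_mj] := eqVneq (u j) 0.
  by apply: eq_weighted_form (weighted_form0 _ _ _) => v; rewrite u0 mul0r.
apply: weighted_formZ.
have sum1 (w : 'I_r.+1 -> int) : \sum_i w i * ((i == j : nat)%:Z) = w j.
  rewrite (bigD1 j) //= eqxx mulr1 big1 ?addr0 // => i /negPf ->.
  by rewrite mulr0.
have := @weighted_form_monomial 1 a m (fun i => (i == j)%N).
rewrite sum1 (bigD1 j) //= eqxx big1 => [|i /negPf -> //].
move=> /(_ erefl le_mj); apply: eq_weighted_form => v.
rewrite (bigD1 j) //= eqxx big1 ?mulr1 ?expr1 // => i /negPf -> //.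
Qed.

(** A variable of weight [b i] is replaced by a linear form in variables of weight at least [b i],
    so no monomial loses weight. For [a = b] the invertible [U] allowed here form a parabolic
    subgroup attached to [a]. *)
Lemma weighted_form_subst d (F : Form k r d) a b m (U : 'M[k]_r.+1) :
  weights_ge b m F -> (forall i j, U i j != 0 -> b i <= a j) ->
  weighted_form d a m (fun v => evalF F (U *m v)).
Proof.
move=> wF le_ba; apply: weighted_form_sum => e.
have [F0|/wF le_m] := eqVneq (F e) 0.
  by apply: eq_weighted_form (weighted_form0 _ _ _) => v; rewrite F0 mul0r.
apply: weighted_formZ; apply: weighted_form_le le_m _.
rewrite -[d in weighted_form d](eqP (valP e)).
under eq_bigr do rewrite -[nat_of_ord _]mul1n.
apply: weighted_form_prod => i; apply: weighted_formX.
apply: eq_weighted_form (weighted_form_linear (le_ba i)) => v.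
by rewrite mxE.
Qed.


(** * The action on forms, and coordinate changes moving points *)

Lemma evalF_act d (g : 'M[k]_r.+1) (f : Form k r d) v :
  evalF (act g f) v = evalF f (g^T *m v).
Proof.
rewrite /act; move: v.
apply: (epsilon_spec _ (fun F : Form k r d => forall v, evalF F v = evalF f (g^T *m v))).
(* With all weights zero the weight conditions are trivial, and substitution supplies the form that
   [epsilon] has to choose. *)
have [||F [_ evF]] := @weighted_form_subst d f [ffun=> 0] [ffun=> 0] 0 g^T.
- by move=> e _; rewrite /wt big1 // => i _; rewrite ffunE mul0r.
- by move=> i j _; rewrite !ffunE.
by exists F => w; rewrite -evF.
Qed.

Lemma weights_ge_subst d (F G : Form k r d) a b m (U : 'M[k]_r.+1) :
  weights_ge b m F -> (forall i j, U i j != 0 -> b i <= a j) ->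
  (forall v, evalF G v = evalF F (U *m v)) -> weights_ge a m G.
Proof.
move=> wF le_ba evG; have [G' [wG' evG']] := weighted_form_subst wF le_ba.
by rewrite (_ : G = G') //; apply: evalF_inj => v; rewrite evG evG'.
Qed.

Lemma act_neq0 d (g : 'M[k]_r.+1) (f : Form k r d) :
  g \in unitmx -> f != 0 -> act g f != 0.
Proof.
move=> gU; apply: contra_neq => gf0; apply: evalF_inj => v.
have -> : v = g^T *m (invmx g^T *m v) by rewrite mulKVmx // unitmx_tr.
rewrite -evalF_act gf0 /evalF [LHS]big1 ?[RHS]big1 // => e _;
  by rewrite ffunE mul0r.
Qed.

Lemma form_neq0P d (F : Form k r d) : F != 0 -> exists e, F e != 0.
Proof.
move=> F0; apply/existsP; apply: contraNT F0; rewrite negb_exists => /forallP F0.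
by apply/eqP/ffunP => e; rewrite ffunE; apply/eqP; have := F0 e; rewrite negbK.
Qed.

Definition id_with_col (q : 'cV[k]_r.+1) (j : 'I_r.+1) : 'M[k]_r.+1 :=
  \matrix_(i, l) if l == j then q i 0 else (i == l)%:R.

Lemma id_with_col_unit (q : 'cV[k]_r.+1) j : q j 0 != 0 -> id_with_col q j \in unitmx.
Proof.
move=> qj; rewrite -row_free_unit -kermx_eq0; apply/rowV0P => u /sub_kermxP u0.
have uE l : l != j -> u 0 l = 0.
  move=> ne; have := congr1 (fun w : 'rV_r.+1 => w 0 l) u0.
  rewrite !mxE (bigD1 l) //= big1.
    by rewrite mxE (negPf ne) eqxx mulr1 addr0.
  by move=> i /negPf ni; rewrite mxE (negPf ne) ni mulr0.
apply/rowP => l; rewrite mxE; have [->|/uE //] := eqVneq l j.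
have := congr1 (fun w : 'rV_r.+1 => w 0 j) u0; rewrite !mxE (bigD1 j) //= big1.
  by rewrite mxE eqxx addr0 => /eqP; rewrite mulf_eq0 (negPf qj) orbF => /eqP.
by move=> i /uE ->; rewrite mul0r.
Qed.

Lemma id_with_col_delta (q : 'cV[k]_r.+1) j : id_with_col q j *m delta_mx j 0 = q.
Proof. by rewrite -colE; apply/colP => i; rewrite !mxE eqxx. Qed.

Lemma cV_neq0P (q : 'cV[k]_r.+1) : q != 0 -> exists j, q j 0 != 0.
Proof.
move=> q0; apply/existsP; apply: contraNT q0; rewrite negb_exists => /forallP q0.
by apply/eqP/colP => e; rewrite mxE; apply/eqP; have := q0 e; rewrite negbK.
Qed.

Lemma e0E : e0 k r = delta_mx ord0 0.
Proof. by apply/colP => i; rewrite !mxE eqxx andbT; case: eqP. Qed.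

Lemma unitmx_to_point (p : 'cV[k]_r.+1) :
  p != 0 -> exists g : 'M[k]_r.+1, g \in unitmx /\ g^T *m e0 k r = p.
Proof.
case/cV_neq0P=> j pj.
(* Since [p] may vanish at [ord0], the first basis vector is sent to the [j]-th one, where [p] is
   nonzero, and then to [p]. *)
exists (id_with_col p j *m tperm_mx j ord0)^T.
rewrite trmxK unitmx_tr unitmx_mul id_with_col_unit // unitmx_perm.
split=> //; rewrite -mulmxA -[RHS](id_with_col_delta p j); congr mulmx.
rewrite e0E -colE; apply/colP => i; rewrite !mxE andbT.
by rewrite -[X in _ == X](tpermL j ord0) (inj_eq perm_inj).
Qed.

Lemma mult_pt_spec d (f : Form k r d) p : p != 0 ->
  exists g : 'M[k]_r.+1,
    [/\ g \in unitmx, g^T *m delta_mx ord0 0 = p & mult_pt f p = mult_e (act g f)].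
Proof.
move=> /unitmx_to_point/(epsilon_spec (inhabits 1%:M)) [gU gp].
by rewrite -e0E /mult_pt; eexists; split; [exact: gU | exact: gp | reflexivity].
Qed.

(** * Multiplicity and [mu] as minima over monomials *)

Lemma foldr_minn_le n (s : seq nat) x : x \in n :: s -> (foldr minn n s <= x)%N.
Proof.
elim: s x => [|y s IHs] x; first by rewrite inE => /eqP->.
rewrite !inE /= orbCA geq_min => /orP[/eqP->|xs]; first by rewrite leqnn.
by rewrite IHs ?inE ?orbT.
Qed.

Lemma foldr_minn_mem n (s : seq nat) : foldr minn n s \in n :: s.
Proof.
elim: s => [|y s IHs] /=; first by rewrite inE.
rewrite !inE orbCA /minn; case: ltnP => _; first by rewrite eqxx.
by rewrite -in_cons IHs orbT.
Qed.

Lemma mult_e_le d (F : Form k r d) e : F e != 0 -> (mult_e F <= d - sval e ord0)%N.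
Proof.
move=> Fe; apply: foldr_minn_le; rewrite inE; apply/orP; right.
by apply/mapP; exists e; rewrite // mem_filter Fe mem_enum.
Qed.

Lemma mult_e_le_deg d (F : Form k r d) : (mult_e F <= d)%N.
Proof. by apply: foldr_minn_le; rewrite mem_head. Qed.

Lemma mult_eP d (F : Form k r d) : F != 0 ->
  exists2 e, F e != 0 & mult_e F = (d - sval e ord0)%N.
Proof.
case/form_neq0P=> e Fe; have := foldr_minn_mem d
  [seq (d - nat_of_ord (sval e (@ord0 r)))%N | e : monom r d <- enum {: monom r d} & F e != 0].
rewrite -/(mult_e F) inE => /orP[/eqP md|/mapP[e']]; last first.
  by rewrite mem_filter => /andP[Fe' _] ->; exists e'.
(* If the minimum is the default value [d], every monomial of [F] attains it, as
   [mult_e F <= d - e_0 <= d]. *)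
by exists e => //; apply/eqP; rewrite eqn_leq mult_e_le // md leq_subr.
Qed.

Lemma minz_mem (s : seq int) : s != [::] -> minz s \in s.
Proof.
case: s => // x0 s _; rewrite /minz /=.
have mem t : foldr (fun x y => if x < y then x else y) x0 t \in x0 :: t.
  elim: t => [|y t IHt] /=; first by rewrite inE.
  by rewrite !inE orbCA; case: ifP => _; rewrite ?eqxx // -in_cons IHt orbT.
by case: ifP => _; [rewrite mem_head | apply: mem].
Qed.

Lemma minz_le (s : seq int) x : x \in s -> minz s <= x.
Proof.
rewrite /minz; move: (head _ _) => x0; elim: s => //= y s IHs; rewrite inE.
case: (ltP y) => [lt_y|le_y] /orP[/eqP->//|xs].
  by apply: ltW (lt_le_trans lt_y _); apply: IHs.
by apply: IHs.
Qed.

Lemma mu_diag_weights d a (F : Form k r d) : weights_ge a (mu_diag a F) F.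
Proof.
move=> e Fe; apply: minz_le; apply/mapP; exists e => //.
by rewrite mem_filter Fe mem_enum.
Qed.

Lemma mu_diag_ge d a m (F : Form k r d) :
  F != 0 -> weights_ge a m F -> m <= mu_diag a F.
Proof.
case/form_neq0P=> e Fe wF.
have /minz_mem/mapP[e'] : [seq wt a e | e <- enum {: monom r d} & F e != 0] != [::].
  have : e \in [seq e <- enum {: monom r d} | F e != 0].
    by rewrite mem_filter Fe mem_enum.
  by case: filter.
by rewrite mem_filter /mu_diag => /andP[/wF le_m _] ->.
Qed.

End Weights.

(** * Optimality of lambda as an inequality between integers *)

Section Stratum.
Variables (k : closedFieldType) (r d : nat).
Implicit Types (a c : {ffun 'I_r.+1 -> int}) (m M : int) (f : Form k r d).

Definition dotz a c : int := \sum_i a i * c i.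

Lemma normv_sqr a : normv a ^+ 2 = (dotz a a)%:~R.
Proof.
rewrite /normv sqrtCK /dotz; rewrite rmorph_sum.
by apply: eq_bigr => i _; rewrite /= expr2.
Qed.

Lemma dotz_ge0 a : 0 <= dotz a a.
Proof. by apply: sumr_ge0 => i _; rewrite -expr2 sqr_ge0. Qed.

Lemma normv_ge0 a : 0 <= normv a.
Proof.
by rewrite /normv sqrtC_ge0 sumr_ge0 // => i _; rewrite ler0z sqr_ge0.
Qed.

Definition lincomb (N : int) a c : {ffun 'I_r.+1 -> int} :=
  [ffun i => N * a i + c i].

Lemma dotz_lincomb N a c : dotz (lincomb N a c) (lincomb N a c) =
  N ^+ 2 * dotz a a + 2 * N * dotz a c + dotz c c.
Proof.
rewrite /dotz !big_distrr -!big_split; apply: eq_bigr => i _ /=.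
by rewrite !ffunE; ring.
Qed.

Lemma weights_ge_lincomb (N : int) a c m M f : 0 <= N ->
  weights_ge a m f -> weights_ge c M f ->
  weights_ge (lincomb N a c) (N * m + M) f.
Proof.
move=> N0 wa wc e fe.
rewrite (_ : wt _ e = N * wt a e + wt c e).
  by rewrite lerD ?ler_wpM2l ?wa ?wc.
rewrite /wt big_distrr -big_split; apply: eq_bigr => i _ /=.
by rewrite ffunE mulrDl mulrA.
Qed.

(** The terms in [N ^+ 2] cancel; if [A * M] exceeded [m * I], the linear term would violate the
    inequality for large [N]. *)
Lemma le_of_asymptotic_sqr (A C I m M : int) : 0 <= A -> 0 < m ->
  (forall N : int, 0 <= N -> 0 <= N * m + M ->
    (N * m + M) ^+ 2 * A <= m ^+ 2 * (N ^+ 2 * A + 2 * N * I + C)) ->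
  A * M <= m * I.
Proof.
move=> A0 m0 le_sqr; rewrite leNgt; apply/negP => lt_mI.
(* [N >= |M|] makes [N * m + M] nonnegative, and [N > m ^+ 2 * |C|] lets the linear term dominate
   the constant one. *)
pose N : int := `|M| + m ^+ 2 * `|C| + 1.
have m2C : 0 <= m ^+ 2 * `|C| by rewrite mulr_ge0 ?sqr_ge0.
have N0 : 0 < N by rewrite /N; lia.
have NM : 0 <= N * m + M.
  have : N <= N * m by rewrite ler_peMr //; lia.
  rewrite /N; lia.
have := le_sqr N (ltW N0) NM; apply/negP; rewrite -ltNge.
rewrite -subr_gt0.
have -> : (N * m + M) ^+ 2 * A - m ^+ 2 * (N ^+ 2 * A + 2 * N * I + C) =
  2 * (N * (m * (A * M - m * I))) + M ^+ 2 * A - m ^+ 2 * C by ring.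
have h1 : N <= N * (m * (A * M - m * I)).
  by rewrite ler_peMr ?(ltW N0) // mulr_ege1 //; lia.
have h2 : 0 <= M ^+ 2 * A by rewrite mulr_ge0 ?sqr_ge0.
have h3 : m ^+ 2 * C <= m ^+ 2 * `|C| by rewrite ler_wpM2l ?sqr_ge0 ?ler_norm.
rewrite {1}/N in h1; lia.
Qed.

Variables (f : Form k r d) (a : {ffun 'I_r.+1 -> int}) (delta : algC) (m : int).
Hypotheses (f_neq0 : f != 0) (sum_a : \sum_i a i = 0) (delta_gt0 : 0 < delta).
Hypotheses (m_def : m%:~R / normv a = delta) (a_stratum : in_stratum f a delta).

Lemma stratum_normv_gt0 : 0 < normv a.
Proof.
(* A zero norm would make the ratio 0, by the convention for division by zero, against
   [0 < delta]. *)
rewrite lt_def normv_ge0 andbT; apply: contraTneq delta_gt0 => a0.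
by rewrite -m_def a0 invr0 mulr0 ltxx.
Qed.

Lemma stratum_mu_gt0 : 0 < m.
Proof.
by move: delta_gt0; rewrite -m_def pmulr_lgt0 ?invr_gt0 ?stratum_normv_gt0 // ltr0z.
Qed.

(** This is maximality of [delta] with denominators cleared and both sides squared, which brings it
    back to [int]; [0 <= L] makes squaring monotone. *)
Lemma stratum_sqr_le (h : 'M[k]_r.+1) c L :
  h \in unitmx -> \sum_i c i = 0 -> weights_ge c L (act (invmx h) f) -> 0 <= L ->
  L ^+ 2 * dotz a a <= m ^+ 2 * dotz c c.
Proof.
move=> hU sum_c wL L0.
have F0 : act (invmx h) f != 0 by rewrite act_neq0 // unitmx_inv.
(* Maximality is assumed for nonzero [c] only; for [c = 0] all weights vanish and so does [L]. *)
have [c0|c_neq0] := eqVneq c 0.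
  have [e /wL leL] := form_neq0P F0.
  have -> : L = 0.
    apply/eqP; rewrite eq_le L0 andbT (le_trans leL) // c0 /wt big1 // => i _.
    by rewrite ffunE mul0r.
  by rewrite expr0n mul0r mulr_ge0 ?sqr_ge0 ?dotz_ge0.
have c_gt0 : 0 < normv c.
  rewrite lt_def normv_ge0 andbT -sqrf_eq0 normv_sqr intr_eq0.
  apply: contra c_neq0; rewrite psumr_eq0 => [/allP c0|i _]; last first.
    by rewrite -expr2 sqr_ge0.
  apply/eqP/ffunP => i; rewrite ffunE; apply/eqP.
  by have := c0 i (mem_index_enum i); rewrite -expr2 sqrf_eq0.
have := a_stratum.2 h c hU sum_c c_neq0; rewrite /ratio /mu -m_def.
rewrite ler_pdivrMr // mulrAC ler_pdivlMr ?stratum_normv_gt0 // => le_mu.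
have leL : L%:~R * normv a <= m%:~R * normv c.
  apply: le_trans le_mu; rewrite ler_wpM2r ?normv_ge0 // ler_int.
  exact: mu_diag_ge.
have sqrE x b : ((x ^+ 2 * dotz b b)%:~R = (x%:~R * normv b) ^+ 2 :> algC).
  by rewrite exprMn normv_sqr rmorphM /= rmorphXn.
rewrite -(ler_int algC) !sqrE; by rewrite ler_pXn2r // nnegrE mulr_ge0 ?normv_ge0 // ler0z // ltW ?stratum_mu_gt0.
Qed.

(* The maximum of mu/||.|| on a torus is attained at the closest point of the
   weight polytope; comparing lambda with its perturbations N a + c, N -> oo,
   gives the corresponding supporting hyperplane inequality. *)
Lemma stratum_dotz_le (h : 'M[k]_r.+1) c M :
  h \in unitmx -> \sum_i c i = 0 ->
  weights_ge a m (act (invmx h) f) -> weights_ge c M (act (invmx h) f) ->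
  dotz a a * M <= m * dotz a c.
Proof.
move=> hU sum_c wa wc.
apply: (@le_of_asymptotic_sqr _ (dotz c c)); rewrite ?dotz_ge0 ?stratum_mu_gt0 //.
move=> N N0 NM; rewrite -dotz_lincomb; apply: (stratum_sqr_le hU) => //.
  under eq_bigr do rewrite ffunE.
  by rewrite big_split -big_distrr /= sum_a sum_c mulr0 addr0.
exact: weights_ge_lincomb.
Qed.


(* g moves the frame of lambda inside the parabolic subgroup P(lambda), until
   p becomes a coordinate point: the coordinate j is chosen with a_j maximal
   among the nonzero coordinates of p. *)
Lemma adapted_frame (g : 'M[k]_r.+1) (p : 'cV[k]_r.+1) :
  g \in unitmx -> p != 0 -> weights_ge a m (act (invmx g) f) ->
  exists h j, [/\ h \in unitmx, weights_ge a m (act (invmx h) f) &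
    (invmx h)^T *m delta_mx j 0 = p].
Proof.
move=> gU p_neq0 wa; pose q := g^T *m p.
have gq : (invmx g)^T *m q = p by rewrite trmx_inv mulKmx ?unitmx_tr.
have /cV_neq0P[i0 qi0] : q != 0.
  by apply: contraNneq p_neq0 => q0; rewrite -gq q0 mulmx0.
pose j := [arg max_(i > i0 | q i 0 != 0) a i]%O.
have [qj le_aj] : q j 0 != 0 /\ forall i, q i 0 != 0 -> a i <= a j.
  by rewrite /j; case: Order.TotalTheory.arg_maxP.
pose U := id_with_col q j.
have UU : U \in unitmx by apply: id_with_col_unit.
(* The new frame is chosen so that its inverse transpose is [(invmx g)^T *m U], which maps the
   [j]-th basis vector to [q] and then to [p]. *)
exists (invmx ((invmx g)^T *m U)^T), j.
have hU : ((invmx g)^T *m U)^T \in unitmx.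
  by rewrite unitmx_tr unitmx_mul unitmx_tr unitmx_inv gU.
rewrite unitmx_inv invmxK trmxK -mulmxA id_with_col_delta; split=> //.
apply: (@weights_ge_subst k r d _ _ a a m U wa) => [i l|v].
  (* Column [j] of [U] is [q], where the condition is maximality of [a j]; the other columns are
     those of the identity. *)
  rewrite mxE; have [->|_] := eqVneq l j; first exact: le_aj.
  by have [->|_] := eqVneq i l; rewrite ?eqxx.
by rewrite !evalF_act trmxK mulmxA.
Qed.

(** * Weights singling out one coordinate, and the bounds at a point *)

Definition step_weight (x y : int) (j : 'I_r.+1) : {ffun 'I_r.+1 -> int} :=
  [ffun i => x + y * (i == j)%:R].

Lemma sum_step (x y : int) j (u : 'I_r.+1 -> int) :
  \sum_i step_weight x y j i * u i = x * (\sum_i u i) + y * u j.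
Proof.
under eq_bigr do rewrite ffunE mulrDl.
rewrite big_split -big_distrr /=; congr (_ + _).
rewrite (bigD1 j) //= eqxx mulr1 big1 ?addr0 // => i /negPf ->.
by rewrite mulr0 mul0r.
Qed.

Lemma sum_monom (e : monom r d) : \sum_i (sval e i : nat)%:Z = d%:Z.
Proof. by rewrite -[in RHS](eqP (valP e)) (big_morph Posz PoszD erefl). Qed.

Lemma wt_step (x y : int) j (e : monom r d) :
  wt (step_weight x y j) e = x * d%:Z + y * (sval e j : nat)%:Z.
Proof. by rewrite /wt sum_step sum_monom. Qed.

(** Column [j] of [U] is the [i]-th basis vector, so only the [i]-th variable, of the same weight
    [x + y], can involve the [j]-th one; all other variables of [G] have the largest weight [x].
    Thus such bounds depend on the point and not on the frame. *)
Lemma weights_ge_step (F G : Form k r d) x y i j M (U : 'M[k]_r.+1) :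
  y <= 0 -> U *m delta_mx j 0 = delta_mx i 0 :> 'cV_r.+1 ->
  (forall v, evalF G v = evalF F (U *m v)) ->
  weights_ge (step_weight x y i) M F -> weights_ge (step_weight x y j) M G.
Proof.
move=> y_le0 Uj evG wF; apply: weights_ge_subst wF _ evG => l l'.
rewrite !ffunE lerD2l; have [->|_ _] := eqVneq l' j; last first.
  by rewrite mulr0 mulr_le0_ge0 ?ler0n.
have := congr1 (fun w : 'cV_r.+1 => w l 0) Uj; rewrite -colE !mxE andbT => ->.
by case: (l =P i); rewrite ?eqxx.
Qed.

Lemma mina_le i : mina a <= a i.
Proof. exact: Order.TotalTheory.bigmin_le. Qed.

Lemma le_maxa i : a i <= maxa a.
Proof. exact: Order.TotalTheory.le_bigmax. Qed.

Lemma mina_attained : exists j, mina a = a j.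
Proof.
rewrite /mina; elim/big_ind: _ => [|x y [i ->] [j ->]|i _]; first by exists ord0.
  by rewrite /Order.min; case: ifP; eexists.
by exists i.
Qed.

Lemma mult_pt_le (g : 'M[k]_r.+1) p :
  g \in unitmx -> p != 0 -> weights_ge a m (act (invmx g) f) ->
  dotz a a * (r.+1%:Z * (mult_pt f p)%:Z - r%:Z * d%:Z)
    <= - (m * (r.+1%:Z * mina a)).
Proof.
move=> gU p_neq0 wg; have [h [j [hU wh hp]]] := adapted_frame gU p_neq0 wg.
have [g0 [g0U g0p ->]] := mult_pt_spec f p_neq0.
set n := mult_e _.
(* The entries are 1, except [-r] at the chosen coordinate, so the sum is zero. *)
pose c := step_weight 1 (- r.+1%:Z).
have sum_c : \sum_i c j i = 0.
  transitivity (\sum_i c j i * 1); first by under [RHS]eq_bigr do rewrite mulr1.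
  rewrite sum_step big_const_ord iter_addr_0 mulr1 mul1r.
  by rewrite -natz subrr.
have g0tU : g0^T \in unitmx by rewrite unitmx_tr.
(* Multiplicity [n] means [e_0 <= d - n] for all monomials, and
   [d - (r+1)(d - n) = (r+1) n - r d]. *)
have w0 : weights_ge (c ord0) (r.+1%:Z * n%:Z - r%:Z * d%:Z) (act g0 f).
  move=> e /mult_e_le; rewrite -/n wt_step => le_n.
  have le_e : (sval e ord0 <= d)%N by rewrite -ltnS.
  have {le_n} : n%:Z <= d%:Z - (sval e ord0 : nat)%:Z by lia.
  move=> /(ler_wpM2l (isT : 0 <= r.+1%:Z)); rewrite mulrBr lerBrDr lerBlDr.
  move=> /le_trans le_n; rewrite mulNr mul1r addrAC lerBrDr; apply: le_n.
  by rewrite -{1}addn1 PoszD mulrDl mul1r addrC.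
(* Both frames have [p] as a coordinate point, so the bound passes from [g0] to the frame [h]
   adapted to lambda. *)
have wj : weights_ge (c j) (r.+1%:Z * n%:Z - r%:Z * d%:Z) (act (invmx h) f).
  apply: (@weights_ge_step _ _ _ _ _ _ _ (invmx g0^T *m (invmx h)^T) _ _ _ w0) => //.
    by rewrite -mulmxA hp -g0p mulKmx.
  by move=> v; rewrite !evalF_act -mulmxA mulKVmx.
apply: le_trans (stratum_dotz_le hU sum_c wh wj) _.
rewrite -mulrN ler_wpM2l ?(ltW stratum_mu_gt0) //.
rewrite /dotz; under eq_bigr do rewrite mulrC; rewrite sum_step sum_a mulr0 add0r.
by rewrite mulNr lerN2 ler_wpM2l ?mina_le.
Qed.

Lemma mult_pt_ge (g : 'M[k]_r.+1) :
  g \in unitmx -> weights_ge a m (act (invmx g) f) ->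
  exists2 p, p != 0 &
    m - mina a * d%:Z <= (maxa a - mina a) * (mult_pt f p)%:Z.
Proof.
move=> gU wg; have [j aj] := mina_attained.
set D := maxa a - mina a.
have D_ge0 : 0 <= D by rewrite subr_ge0 aj le_maxa.
have gtU : (invmx g)^T \in unitmx by rewrite unitmx_tr unitmx_inv.
pose p : 'cV[k]_r.+1 := (invmx g)^T *m delta_mx j 0.
have p_neq0 : p != 0.
  apply/eqP => p0; have := mulKmx gtU (delta_mx j 0 : 'cV[k]_r.+1).
  rewrite -/p p0 mulmx0 => /(congr1 (fun w : 'cV_r.+1 => w j 0)).
  by rewrite !mxE !eqxx => /eqP; rewrite eq_sym oner_eq0.
exists p => //; have [g0 [g0U g0p ->]] := mult_pt_spec f p_neq0.
pose w := step_weight D (- D).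
(* Subtracting [mina a] from every [a i] lowers the weight by [mina a * d], and each difference is
   at most the entry of [w j]: it is 0 at [j] and at most [D] elsewhere. *)
have wj : weights_ge (w j) (m - mina a * d%:Z) (act (invmx g) f).
  move=> e /wg le_m; rewrite lerBlDr; apply: le_trans le_m _.
  rewrite -(sum_monom e) big_distrr -big_split ler_sum // => i _ /=.
  rewrite -mulrDl ler_wpM2r // ffunE; have [->|_] := eqVneq i j.
    by rewrite mulr1 subrr add0r aj.
  by rewrite mulr0 addr0 /D subrK le_maxa.
have w0 : weights_ge (w ord0) (m - mina a * d%:Z) (act g0 f).
  apply: (@weights_ge_step _ _ _ _ _ _ _ (invmx (invmx g)^T *m g0^T) _ _ _ wj).
  - by rewrite oppr_le0.
  - by rewrite -mulmxA g0p mulKmx.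
  - by move=> v; rewrite !evalF_act -mulmxA mulKVmx.
have [e Fe ->] := mult_eP (act_neq0 g0U f_neq0).
have le_e : (sval e ord0 <= d)%N by rewrite -ltnS.
have := w0 e Fe; rewrite wt_step => /le_trans; apply.
by rewrite -subzn // mulrBr mulNr.
Qed.

End Stratum.

(** * The maximum over points and the final estimates *)

Lemma attainedP (k : closedFieldType) (r d : nat) (f : Form k r d) j :
  reflect (exists p : 'cV[k]_r.+1, p != 0 /\ mult_pt f p = j) (attained f j).
Proof. by rewrite /attained; case: excluded_middle_informative => h; constructor. Qed.

Lemma mult_pt_le_multX (k : closedFieldType) (r d : nat) (f : Form k r d)
  (p : 'cV[k]_r.+1) : p != 0 -> (mult_pt f p <= multX f)%N.
Proof.
move=> p0; have lt_d : (mult_pt f p < d.+1)%N by rewrite ltnS mult_e_le_deg.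
apply: (@leq_bigmax_cond _ _ (@nat_of_ord d.+1) (Ordinal lt_d)).
by apply/attainedP; exists p.
Qed.

(** The given [p] makes the index set of the maximum nonempty, excluding the default value 0. *)
Lemma multX_attained (k : closedFieldType) (r d : nat) (f : Form k r d)
  (p : 'cV[k]_r.+1) : p != 0 ->
  exists q : 'cV[k]_r.+1, q != 0 /\ multX f = mult_pt f q.
Proof.
move=> p0; have lt_d : (mult_pt f p < d.+1)%N by rewrite ltnS mult_e_le_deg.
have ne : (0 < #|[pred i : 'I_d.+1 | attained f i]|)%N.
  by apply/card_gt0P; exists (Ordinal lt_d); apply/attainedP; exists p.
have [i /attainedP[q [q0 qi]]] := eq_bigmax_cond (@nat_of_ord d.+1) ne.
by exists q; split; rewrite // qi.
Qed.

Theorem theorem4p3 (k : closedFieldType) (r d : nat)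
  (hr : (1 <= r)%N) (hd : (1 <= d)%N)
  (f : Form k r d) (hf : f != 0)
  (a : {ffun 'I_r.+1 -> int}) (ha : \sum_i a i = 0) (hind : indivisible a)
  (delta : algC) (hdelta : 0 < delta) (hE : in_stratum f a delta) :
  ((normv a * delta - (mina a)%:~R * d%:R) / ((maxa a)%:~R - (mina a)%:~R)
     <= (multX f)%:R)
  /\ ((multX f)%:R
     <= (r * d)%:R / (r.+1)%:R - delta * (mina a)%:~R / normv a).
Proof.
have [g [gU m_def]] := hE.1; move: m_def; rewrite /Defs.ratio.
set m := mu f g a => m_def.
have wg : weights_ge a m (act (invmx g) f) by apply: mu_diag_weights.
have a_gt0 := stratum_normv_gt0 hdelta m_def.
have a_neq0 : normv a != 0 by rewrite gt_eqF.
have [p p_neq0 le_p] := mult_pt_ge hf gU wg.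
split.
  have -> : normv a * delta = m%:~R by rewrite -m_def mulrC divfK.
  (* If the denominator is zero, the quotient is 0 by convention and the bound is immediate. *)
  rewrite -[X in _ / X]rmorphB; have [D0|D_neq0] := eqVneq (maxa a - mina a) 0.
    by rewrite D0 invr0 mulr0 ler0n.
  have D_gt0 : 0 < maxa a - mina a.
    by rewrite lt_def D_neq0 subr_ge0 (le_trans (mina_le a ord0)) ?le_maxa.
  rewrite ler_pdivrMr ?ltr0z //= [leRHS]mulrC.
  have -> : m%:~R - (mina a)%:~R * d%:R = (m - mina a * d%:Z)%:~R :> algC.
    by rewrite rmorphB rmorphM /= -pmulrn.
  rewrite -[(multX f)%:R]/((multX f)%:Z%:~R) -rmorphM ler_int.
  apply: le_trans le_p _; rewrite ler_wpM2l ?(ltW D_gt0) //.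
  exact: mult_pt_le_multX.
have [q [q_neq0 ->]] := multX_attained f p_neq0.
have := mult_pt_le hf ha hdelta m_def hE gU q_neq0 wg.
rewrite -(ler_int algC) rmorphN !rmorphM rmorphB !rmorphM /= -normv_sqr => le_q.
have a2_gt0 : 0 < normv a ^+ 2 by rewrite exprn_gt0.
have r1_gt0 : 0 < r.+1%:R :> algC by rewrite ltr0n.
(* After scaling by [normv a ^+ 2 * (r+1)] and putting [delta = m / normv a], the difference of the
   two sides equals that in [le_q]. *)
rewrite -(ler_pM2l (mulr_gt0 a2_gt0 r1_gt0)) -subr_ge0.
rewrite -subr_ge0 in le_q; apply: le_trans le_q _.
rewrite -m_def le_eqVlt; apply/orP; left; apply/eqP.
rewrite -!pmulrn; field.
by rewrite a_neq0 addrC natr1 gt_eqF.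
Qed.
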